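(* Let $q$ be a prime power and let $G,H$ be finite groups with $|G|=q^n$ and $|H|=q$. Then there is a chain of subgroups $\mathcal{C}:\ \{e\}=H_0\subsetneq H_1\subsetneq\dots\subsetneq H_n=G$ with $[H_i:H_{i-1}]=q$ for $i=1,\dots,n$ such that $(G,d_{\mathcal{C}})$ is isometric to $(H^n,d_{RT})$.
   Context: The chain metric of $\mathcal{C}$ is $d_{\mathcal{C}}(x,y)=i$ if $xy^{-1}\in H_i\setminus H_{i-1}$, $i=0,\dots,n$, with $H_{-1}=\varnothing$. The Rosenbloom–Tsfasman metric on $H^n$ is $d_{RT}(x,y)=\max\{1\le i\le n: x_i\ne y_i\}$ for $x\ne y$ and $d_{RT}(x,x)=0$. An isometry is a distance-preserving bijection. *)

(* Defs.v *)
From mathcomp Require Import all_boot all_fingroup.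

Set Implicit Arguments.
Unset Strict Implicit.
Unset Printing Implicit Defensive.

Import GroupScope.

Definition prime_power (q : nat) : Prop :=
  exists p k : nat, [/\ prime p, (0 < k)%N & q = (p ^ k)%N].

(* A chain {e} = C 0 < C 1 < ... < C n of subgroups of the group carried by gT, *)
(* ending at the whole group, is a function on nat whose values beyond n are    *)
(* irrelevant.                                                                  *)
Definition subgroup_chain (gT : finGroupType) (n : nat)
    (C : nat -> {group gT}) : Prop :=
  [/\ C 0%N = 1 :> {set gT},
      forall i : nat, (i < n)%N -> C i \proper C i.+1
    & C n = [set: gT] :> {set gT}].

Definition chain_layer (gT : finGroupType) (C : nat -> {group gT}) (i : nat) :
    {set gT} :=
  C i :\: (if i is j.+1 then C j : {set gT} else set0).

(* When C is a chain, exactly one i <= n qualifies (see chain_distP), so the    *)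
(* default value 0 is never used.                                               *)
Definition chain_dist (gT : finGroupType) (n : nat) (C : nat -> {group gT})
    (x y : gT) : nat :=
  if [pick i : 'I_n.+1 | x * y^-1 \in chain_layer C i] is Some i
  then nat_of_ord i else 0%N.

(* Coordinates are numbered from 0 here and from 1 in the metric, whence i.+1;  *)
(* the empty maximum is 0.                                                      *)
Definition RT_dist (T : eqType) (n : nat) (x y : {ffun 'I_n -> T}) : nat :=
  \max_(i < n | x i != y i) i.+1.

Definition isometry_between (S T : Type) (dS : S -> S -> nat)
    (dT : T -> T -> nat) (f : S -> T) : Prop :=
  bijective f /\ forall x y : S, dT (f x) (f y) = dS x y.

Definition isometric (S T : Type) (dS : S -> S -> nat) (dT : T -> T -> nat) :
    Prop :=
  exists f : S -> T, isometry_between dS dT f.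

Lemma subgroup_chain_sub (gT : finGroupType) (n : nat) (C : nat -> {group gT})
    (i j : nat) :
  subgroup_chain n C -> (i <= j)%N -> (j <= n)%N -> C i \subset C j.
Proof.
case=> _ Cp _; elim: j => [|j IHj]; first by rewrite leqn0 => /eqP ->.
rewrite leq_eqVlt => /orP[/eqP -> // | le_ij lt_jn].
exact: subset_trans (IHj le_ij (ltnW lt_jn)) (proper_sub (Cp j lt_jn)).
Qed.

Lemma chain_distP (gT : finGroupType) (n : nat) (C : nat -> {group gT})
    (x y : gT) (i : nat) :
  subgroup_chain n C -> (i <= n)%N ->
  (chain_dist n C x y = i <-> x * y^-1 \in chain_layer C i).
Proof.
move=> chC le_in.
have uniq_layer z a b : (a < b)%N -> (b <= n)%N ->
    z \in chain_layer C a -> z \notin chain_layer C b.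
  case: b => // b lt_ab lt_bn; rewrite !inE => /andP[_ Ca].
  by rewrite negb_and negbK (subsetP (@subgroup_chain_sub _ _ _ a b chC lt_ab (ltnW lt_bn))).
have layer_inj z a b : (a <= n)%N -> (b <= n)%N ->
    z \in chain_layer C a -> z \in chain_layer C b -> a = b.
  move=> an bn za zb; case: (ltngtP a b) => // [lt_ab | lt_ba].
    by rewrite (negPf (uniq_layer z a b lt_ab bn za)) in zb.
  by rewrite (negPf (uniq_layer z b a lt_ba an zb)) in za.
rewrite /chain_dist; case: pickP => [j zj | none].
  split=> [<- // | zi]; apply: layer_inj zj zi => //.
  by rewrite -ltnS ltn_ord.
have Cz : exists k, x * y^-1 \in C k.
  by exists n; case: chC => _ _ ->; rewrite inE.
have [k zk kmin] := ex_minnP Cz.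
have kn : (k < n.+1)%N.
  by rewrite ltnS kmin //; case: chC => _ _ ->; rewrite inE.
have := none (Ordinal kn); rewrite inE /= zk andbT.
case: (k) kmin => [|k'] kmin; first by rewrite inE.
by move=> /negbFE /kmin; rewrite ltnn.
Qed.

Lemma RT_dist_refl (T : eqType) (n : nat) (x : {ffun 'I_n -> T}) :
  RT_dist x x = 0%N.
Proof. by rewrite /RT_dist big_pred0 // => i; rewrite eqxx. Qed.

(* Main.v *)
Require Import Defs.
From mathcomp Require Import all_boot all_fingroup all_solvable.

(** By the Sylow theory a p-group has a tower of subgroups of orders q^i. The
    j-th coordinate of x records which right coset of C j contains x among the q
    such cosets that make up C j.+1 :* x, so two elements lie in the same coset of
    C i exactly when their coordinates from the i-th on agree. *)

Set Implicit Arguments.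
Unset Strict Implicit.
Unset Printing Implicit Defensive.

Import GroupScope.

(** A [p]-group has subgroups of every order dividing its own, so in the inductive step [K] contains
    some [Q] of index [p ^ k], and [K] is put on top of the tower of [Q]. *)
Lemma pgroup_tower (gT : finGroupType) (p k n : nat) (K : {group gT}) :
  prime p -> #|K| = (p ^ (k * n))%N ->
  exists C : nat -> {group gT},
    [/\ C n = K, forall i, (i <= n)%N -> #|C i| = (p ^ (k * i))%N
      & forall i, (i < n)%N -> C i \subset C i.+1].
Proof.
move=> p_pr; elim: n K => [|n IHn] K oK.
  by exists (fun=> K); split=> // i; rewrite leqn0 => /eqP ->.
have pK : p.-group K by rewrite /pgroup oK pnatX pnat_id.
have le_r : (k * n <= logn p #|K|)%N.
  by rewrite oK pfactorK // leq_mul2l leqnSn orbT.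
have [Q [sQK _ oQ]] := normal_pgroup pK (normal_refl K) le_r.
have [C [Cn oC sC]] := IHn Q oQ.
exists (fun i => if (i <= n)%N then C i else K); split=> [|i|i].
- by rewrite ltnn.
- by rewrite leq_eqVlt ltnS => /orP[/eqP -> | le_in];
    rewrite ?ltnn // le_in oC.
rewrite ltnS leq_eqVlt => /orP[/eqP -> | lt_in].
  by rewrite eqxx ltnn Cn.
by rewrite lt_in orbT sC.
Qed.

Lemma card_le_inj_in (S T : finType) (A : {set S}) (t0 : T) :
  (#|A| <= #|T|)%N -> exists f : S -> T, {in A &, injective f}.
Proof.
(* Ranks in the two enumerations are matched; on [A] the default [t0] is never reached. *)
move=> le_AT; exists (fun s => nth t0 (enum T) (index s (enum A))).
have index_lt s : s \in A -> (index s (enum A) < size (enum T))%N.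
  by move=> As; rewrite -cardE (leq_trans _ le_AT) // cardE index_mem mem_enum.
move=> s1 s2 As1 As2 /eqP; rewrite nth_uniq ?index_lt ?enum_uniq // => /eqP.
by move/(congr1 (nth s1 (enum A))); rewrite !nth_index ?mem_enum.
Qed.

(** Dividing [x] by the representative [r x] of [B :* x] lands in [B], which has only [#|B : A|]
    right cosets of [A]; [e] labels these by elements of [T]. When [x * y^-1] is in [B] the
    representatives of [x] and [y] coincide and cancel. *)
Lemma coset_coordinate (gT : finGroupType) (T : finType) (t0 : T)
    (A B : {group gT}) :
  A \subset B -> (#|B : A| <= #|T|)%N ->
  exists c : gT -> T, forall x y, x * y^-1 \in B ->
    (c x = c y <-> x * y^-1 \in A).
Proof.
move=> sAB le_BT; have [e e_inj] := card_le_inj_in t0 le_BT.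
pose r x := repr (B :* x).
exists (fun x => e (A :* (x * (r x)^-1))) => x y Bxy.
have rxy : r x = r y by congr repr; apply/rcoset_eqP; rewrite mem_rcoset.
have mem_B z : z * (r z)^-1 \in B.
  by rewrite -mem_rcoset; apply/rcoset_eqP; rewrite rcoset_repr.
have cosetP : A :* (x * (r x)^-1) = A :* (y * (r y)^-1) <-> x * y^-1 \in A.
  have -> : x * y^-1 = x * (r x)^-1 * (y * (r y)^-1)^-1.
    by rewrite rxy invMg invgK !mulgA mulgKV.
  by rewrite -mem_rcoset; split=> /rcoset_eqP.
apply: iff_trans cosetP; split=> [eq_e | -> //].
by apply: e_inj => //; apply/rcosetsP; [exists (x * (r x)^-1) | exists (y * (r y)^-1)].
Qed.

Lemma chain_coordinates (gT : finGroupType) (T : finType) (n : nat)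
    (C : nat -> {group gT}) (t0 : T) :
  subgroup_chain n C -> (forall i, (i < n)%N -> #|C i.+1 : C i| <= #|T|)%N ->
  exists f : gT -> {ffun 'I_n -> T}, forall x y i, (i <= n)%N ->
    (x * y^-1 \in C i <-> forall j : 'I_n, (i <= j)%N -> f x j = f y j).
Proof.
move=> chC iC; have [_ _ Cn] := chC.
(* Stated as a boolean property of a finite function, so that [xchoose] can pick a coordinate for
   every [j] at once. *)
have cP (j : 'I_n) : exists c : {ffun gT -> T},
    [forall x, forall y, (x * y^-1 \in C j.+1) ==>
      ((c x == c y) == (x * y^-1 \in C j))].
  have sC := subgroup_chain_sub chC (leqnSn j) (ltn_ord j).
  have [c cE] := coset_coordinate t0 sC (iC j (ltn_ord j)).
  exists (finfun c); apply/forallP=> x; apply/forallP=> y; apply/implyP=> Cxy.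
  by rewrite !ffunE; apply/eqP; apply/eqP/idP=> /(cE x y Cxy).
pose c j := xchoose (cP j).
have cE (j : 'I_n) x y : x * y^-1 \in C j.+1 ->
    (c j x == c j y) = (x * y^-1 \in C j).
  by move/forallP/(_ x)/forallP/(_ y)/implyP: (xchooseP (cP j)) => h /h /eqP.
exists (fun x => [ffun j => c j x]) => x y i le_in; split=> [Cxy j le_ij | eq_f].
  rewrite !ffunE; apply/eqP.
  have Cj : x * y^-1 \in C j.
    exact: subsetP (subgroup_chain_sub chC le_ij (ltnW (ltn_ord j))) _ Cxy.
  rewrite cE //.
  exact: subsetP (subgroup_chain_sub chC (leqnSn j) (ltn_ord j)) _ Cj.
(* Start from [C n], the whole group, and go down: agreement at coordinate [n - d.+1] passes from
   [C (n - d)] to [C (n - d.+1)]. *)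
have descent d : (d <= n - i)%N -> x * y^-1 \in C (n - d)%N.
  elim: d => [_|d IHd lt_d]; first by rewrite subn0 Cn inE.
  have lt_dn : (d < n)%N := leq_trans lt_d (leq_subr i n).
  have lt_jn : (n - d.+1 < n)%N by rewrite ltn_subrL (leq_trans _ lt_dn).
  have := eq_f (Ordinal lt_jn); rewrite !ffunE /= leq_subCr //.
  move=> /(_ lt_d)/eqP; rewrite cE //= -subSn // subSS.
  exact: IHd (ltnW lt_d).
by have := descent _ (leqnn _); rewrite subKn.
Qed.

(** Both distances are the least [i] satisfying one of the two conditions that [fP] shows
    equivalent: [x * y^-1] lies in [C i], or the coordinates of index at least [i] agree. *)
Lemma chain_isometric (gT : finGroupType) (T : finType) (n : nat)
    (C : nat -> {group gT}) (t0 : T) :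
  subgroup_chain n C -> (forall i, (i < n)%N -> #|C i.+1 : C i| <= #|T|)%N ->
  #|gT| = (#|T| ^ n)%N -> isometric (chain_dist n C) (@RT_dist T n).
Proof.
move=> chC iC oG; have [f fP] := chain_coordinates t0 chC iC.
have [C0 _ _] := chC.
exists f; split=> [|x y].
  (* Injectivity is the case [i = 0] of [fP], as [C 0] is trivial. *)
  apply: inj_card_bij; last by rewrite card_ffun card_ord oG.
  move=> x y eq_f; have := fP x y 0%N isT; rewrite C0 inE -eq_mulgV1 => [[_ h]].
  by apply/eqP/h => j _; rewrite eq_f.
set m := RT_dist _ _.
have le_mn : (m <= n)%N by apply/bigmax_leqP=> j _.
apply/esym/(chain_distP x y chC le_mn); rewrite /chain_layer inE andbC.
apply/andP; split.
  apply/fP=> // j le_mj; apply/eqP/negPn/negP=> ne_f.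
  have : (j.+1 <= m)%N by apply: (@leq_bigmax_cond _ _ (fun i : 'I_n => i.+1)).
  by rewrite ltnNge le_mj.
case Dm: m => [|k]; rewrite ?inE //.
(* If [x * y^-1] were in [C k], the coordinates from [k] on would agree and the maximum [m = k.+1]
   would be at most [k]. *)
apply/negP=> /fP-/(_ _)eq_f.
suff : (m <= k)%N by rewrite Dm ltnn.
apply/bigmax_leqP=> j; apply: contraR; rewrite -ltnNge ltnS => le_kj.
by apply/eqP/eq_f => //; rewrite ltnW -?Dm.
Qed.

Theorem theorem7p11 (q n : nat) (G H : finGroupType)
    (hq : prime_power q) (hG : #|G| = (q ^ n)%N) (hH : #|H| = q) :
  exists C : nat -> {group G},
    [/\ subgroup_chain n C,
        forall i : nat, (i < n)%N -> #|C i.+1 : C i| = q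
      & isometric (chain_dist n C) (@RT_dist H n)].
Proof.
have [p [k [p_pr k_gt0 Dq]]] := hq.
(* This makes the orders [q ^ i] strictly increasing, hence the inclusions of the chain proper. *)
have q_gt1 : (1 < q)%N by rewrite Dq -(expn0 p) ltn_exp2l ?prime_gt1.
have oG : #|[set: G]%G| = (p ^ (k * n))%N by rewrite cardsT hG Dq expnM.
have [C [Cn oC sC]] := pgroup_tower p_pr oG.
have oCq i : (i <= n)%N -> #|C i| = (q ^ i)%N by move/oC; rewrite Dq expnM.
have iC i : (i < n)%N -> #|C i.+1 : C i| = q.
  move=> lt_in; rewrite -divgS ?sC // !oCq ?(ltnW lt_in) //.
  by rewrite expnS mulnK // expn_gt0 (ltnW q_gt1).
have chC : subgroup_chain n C.
  split=> [|i lt_in|]; last by rewrite Cn.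
    by apply: card1_trivg; rewrite oCq.
  by rewrite properEcard sC // !oCq ?(ltnW lt_in) // ltn_exp2l /=.
exists C; split=> //.
by apply: (chain_isometric (1 : H) chC) => [i /iC -> |]; rewrite hH.
Qed.
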